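(* Let $L>0$, $\Omega=(-L,L)$, $\alpha\in C(\overline\Omega)$ with $\alpha>0$, and $f(x)=\lambda x$ for every $x\in\Omega$, with $\lambda>0$. Let $-L<x_1\le x_2<L$ and $$u(x)=\begin{cases}\lambda x_1,& x\in(-L,x_1),\\ \lambda x,& x\in[x_1,x_2],\\ \lambda x_2,& x\in(x_2,L).\end{cases}$$ If $u$ is the solution of the weighted total variation problem $$\min_{u\in BV(\Omega)}\ \frac12\int_\Omega (f-u)^2\,dx+\int_\Omega\alpha(x)\,d|Du|,$$ then $x_1=-x_2$. That is, the problem cannot have a solution of this type unless the solution is symmetric with respect to the origin.
   Context: For $u\in BV(\Omega)$, $|Du|$ is the total variation measure of the distributional derivative $Du$. The minimisation problem has a unique solution. *)

(* Defs.v *)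
From HB Require Import structures.
From mathcomp Require Import all_boot all_order all_algebra.
From mathcomp Require Import all_classical all_reals all_analysis.

Set Implicit Arguments.
Unset Strict Implicit.
Unset Printing Implicit Defensive.

Import Order.TTheory GRing.Theory Num.Theory.
Import numFieldNormedType.Exports.

Local Open Scope classical_set_scope.
Local Open Scope ring_scope.

Section charge_integral.
Context d (T : measurableType d) (R : realType).
Implicit Type nu : {charge set T -> \bar R}.

Definition hahn_pos_set nu : set T := sval (cid (Hahn_decomposition nu)).

Definition hahn_neg_set nu : set T :=
  sval (cid (svalP (cid (Hahn_decomposition nu)))).

Lemma hahn_setsP nu :
  hahn_decomposition nu (hahn_pos_set nu) (hahn_neg_set nu).
Proof. exact: (svalP (cid (svalP (cid (Hahn_decomposition nu))))). Qed.

(* The Jordan decomposition, hence each definition below, does not depend on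
   the chosen Hahn decomposition. *)
Definition total_variation_measure nu : {measure set T -> \bar R} :=
  charge_variation (hahn_setsP nu).

Definition charge_integral nu (D : set T) (f : T -> \bar R) : \bar R :=
  (\int[jordan_pos (hahn_setsP nu)]_(x in D) f x
   - \int[jordan_neg (hahn_setsP nu)]_(x in D) f x)%E.

End charge_integral.

Section bounded_variation.
Context (R : realType).
Local Notation mu := (@lebesgue_measure R).
Implicit Types (D : set R) (u v f alpha : R -> R).

Definition smooth_compactly_supported D (phi : R -> R) : Prop :=
  [/\ forall (n : nat) (x : R), derivable (derive1n n phi) x 1,
      compact (closure [set x | phi x != 0])
    & closure [set x | phi x != 0] `<=` D].

(* A finite signed measure on the open set D is encoded as a charge on R that
   vanishes on the measurable sets disjoint from D. *)
Definition is_distributional_derivative D u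
    (nu : {charge set (measurableTypeR R) -> \bar R}) : Prop :=
  (forall A : set (measurableTypeR R), measurable A -> A `&` D = set0 -> nu A = 0%E) /\
  forall phi, smooth_compactly_supported D phi ->
    (\int[mu]_(x in D) (u x * derive1 phi x)%:E
     = - charge_integral nu D (EFin \o phi))%E.

Definition BV D u : Prop :=
  mu.-integrable D (EFin \o u) /\
  exists nu, is_distributional_derivative D u nu.

(* For u in BV(D) the distributional derivative is unique; the value czero is
   only a default outside of BV(D). *)
Definition distributional_derivative D u :
    {charge set (measurableTypeR R) -> \bar R} :=
  match pselect (exists nu, is_distributional_derivative D u nu) with
  | left h => sval (cid h)
  | right _ => czero
  end.

Definition weighted_TV_energy D alpha f u : \bar R :=
  (2^-1%:E * \int[mu]_(x in D) ((f x - u x) ^+ 2)%:E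
   + \int[total_variation_measure (distributional_derivative D u)]_(x in D)
       (alpha x)%:E)%E.

Definition weighted_TV_solution D alpha f u : Prop :=
  BV D u /\
  forall v, BV D v ->
    (weighted_TV_energy D alpha f u <= weighted_TV_energy D alpha f v)%E.

End bounded_variation.

(* Main.v *)
Require Import Defs.
From HB Require Import structures.
From mathcomp Require Import all_boot all_order all_algebra.
From mathcomp Require Import all_classical all_reals all_analysis.
From mathcomp Require Import measurable_realfun ring lra.

(* Adding a constant to the solution [u] changes neither [Du] nor the weighted
   total variation, so minimality of the fidelity term along constants forces
   [f - u] to have mean zero. For the given [u] that integral equals
   [lambda / 2 * ((L - x2) ^+ 2 - (L + x1) ^+ 2)]. *)

Set Implicit Arguments.
Unset Strict Implicit.
Unset Printing Implicit Defensive.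

Import Order.TTheory GRing.Theory Num.Theory.
Import numFieldNormedType.Exports.
Local Open Scope classical_set_scope.
Local Open Scope ring_scope.

(** * Continuous functions on bounded open intervals *)

Lemma continuous_bounded_itvoo (R : realType) (a b : R) (g : R -> R) :
  {within `[a, b], continuous g} -> [bounded g x | x in `]a, b[].
Proof.
move=> cg.
have := compact_bounded (continuous_compact cg (@segment_compact _ a b)).
case=> M [Mr gM]; exists M; split => // N MN x xab.
by apply: (gM _ MN); exists x => //; exact: subset_itv_oo_cc xab.
Qed.

Lemma continuous_integrable_itvoo (R : realType) (a b : R) (g : R -> R) :
  {within `[a, b], continuous g} ->
  (@lebesgue_measure R).-integrable `]a, b[ (EFin \o g).
Proof.
move=> cg; apply: (@integrableS _ _ _ lebesgue_measure [set` `[a, b]]) => //.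
  exact: subset_itv_oo_cc.
exact: continuous_compact_integrable (@segment_compact _ _ _) cg.
Qed.

(** The endpoints are Lebesgue-null, so the fundamental theorem of calculus on the closed interval
    applies. *)
Lemma Rintegral_FTC2_itvoo (R : realType) (a b : R) (g G : R -> R) :
  a < b -> {within `[a, b], continuous g} ->
  (forall x : R, is_derive x 1 G (g x)) ->
  \int[@lebesgue_measure R]_(x in `]a, b[) g x = G b - G a.
Proof.
move=> ab cg dG.
have cG x : {for x, continuous G}.
  by apply/differentiable_continuous/derivable1_diffP/ex_derive.
have -> : \int[@lebesgue_measure R]_(x in `]a, b[) g x =
          fine (\int[@lebesgue_measure R]_(x in `[a, b]) (g x)%:E).
  rewrite /Rintegral integral_itv_bndoo//.
  exact: measurable_int (continuous_integrable_itvoo cg).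
rewrite (@continuous_FTC2 _ g G)//.
- split; [by move=> x _; exact: ex_derive|exact/cvg_at_right_filter/cG|].
  exact/cvg_at_left_filter/cG.
- by move=> x _; rewrite derive1E; exact: derive_val.
Qed.

(** * Adding a constant: effect on the derivative and on the energy *)

Section translation.
Context (R : realType) (a b : R).
Hypothesis ab : a < b.
Local Notation mu := (@lebesgue_measure R).
Local Notation D := ([set` `]a, b[] : set R).

Lemma derive1_test_continuous (phi : R -> R) :
  smooth_compactly_supported D phi -> continuous (derive1 phi).
Proof.
case=> /(_ 1%N) dphi _ _ x; rewrite -derive1n1.
exact/differentiable_continuous/derivable1_diffP.
Qed.

(** The support of [phi] lies in the open interval, so [phi] vanishes at both endpoints and the
    integral is [phi b - phi a = 0]. *)
Lemma Rintegral_derive1_test (phi : R -> R) :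
  smooth_compactly_supported D phi -> \int[mu]_(x in D) derive1 phi x = 0.
Proof.
move=> sphi; have cphi := derive1_test_continuous sphi.
have [dphi _ suppD] := sphi.
have phi0 x : x \notin `]a, b[ -> phi x = 0.
  move=> xD; apply/eqP/contraT => phix; case/negP: xD.
  exact/suppD/subset_closure.
have dphi1 (x : R) : is_derive x 1 phi (derive1 phi x).
  by apply: DeriveDef; [exact: (dphi 0%N)|rewrite derive1E].
rewrite (Rintegral_FTC2_itvoo ab _ dphi1); last exact: continuous_subspaceT.
by rewrite !phi0 ?subrr// in_itv/= ltxx ?andbF.
Qed.

(** The constant contributes [c] times the integral of [derive1 phi], which is zero. The result is
    an equality of predicates so that it can be rewritten under the choice operator in
    [distributional_derivative]. *)
Lemma is_distributional_derivativeDcst (u : R -> R) (c : R) :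
  mu.-integrable D (EFin \o u) ->
  is_distributional_derivative D (fun x => u x + c) =
  is_distributional_derivative D u.
Proof.
move=> iu; apply/funext => nu; apply/propext.
have shift phi : smooth_compactly_supported D phi ->
    (\int[mu]_(x in D) ((u x + c) * derive1 phi x)%:E =
     \int[mu]_(x in D) (u x * derive1 phi x)%:E)%E.
  move=> sphi; have cphi := derive1_test_continuous sphi.
  have wphi : {within `[a, b], continuous (derive1 phi)}.
    exact: continuous_subspaceT.
  have iphi := continuous_integrable_itvoo wphi.
  (* An integrable function times a bounded one: [derive1 phi] is continuous on the closed
     interval. *)
  have iuphi : mu.-integrable D (EFin \o (fun x => u x * derive1 phi x)).
    have -> : EFin \o (fun x => u x * derive1 phi x) =
              ((EFin \o u) \* (EFin \o derive1 phi))%E by [].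
    apply: integrableMl => //.
      by apply/measurable_EFinP; exact: measurable_int iphi.
    exact: continuous_bounded_itvoo.
  have icphi : mu.-integrable D (EFin \o (fun x => c * derive1 phi x)).
    exact: (@integrableZl _ _ _ mu D _ c (EFin \o derive1 phi)).
  under eq_integral do rewrite mulrDl.
  rewrite (@integralD_EFin _ _ _ mu D _ (fun x => u x * derive1 phi x)
    (fun x => c * derive1 phi x))//.
  (* The second integral is finite, so it can be computed as a real integral. *)
  rewrite -[X in (_ + X)%E]fineK ?integrable_fin_num//.
  rewrite -/(Rintegral _ _ _) RintegralZl// Rintegral_derive1_test//.
  by rewrite mulr0 adde0.
by split=> -[nu0 H]; split => // phi sphi; rewrite -H// shift.
Qed.

Lemma BVDcst (u : R -> R) (c : R) : BV D u -> BV D (fun x => u x + c).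
Proof.
case=> iu [nu dnu]; split; last first.
  by exists nu; rewrite is_distributional_derivativeDcst.
apply: (@integrableD _ _ _ mu D _ (EFin \o u) (EFin \o cst c)) => //.
exact/continuous_integrable_itvoo/continuous_subspaceT/cst_continuous.
Qed.

(** Both sides choose a charge satisfying one and the same predicate, so they choose the same
    charge. *)
Lemma distributional_derivativeDcst (u : R -> R) (c : R) :
  mu.-integrable D (EFin \o u) ->
  distributional_derivative D (fun x => u x + c) =
  distributional_derivative D u.
Proof.
move=> iu.
by rewrite /distributional_derivative is_distributional_derivativeDcst.
Qed.

(** A bounded function is integrated against a finite measure. Finiteness is what allows this term
    to be cancelled when two energies are compared. *)
Lemma total_variation_integral_fin_num
    (nu : {charge set (measurableTypeR R) -> \bar R}) (alpha : R -> R) :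
  {within `[a, b], continuous alpha} ->
  (\int[total_variation_measure nu]_(x in D) (alpha x)%:E)%E \is a fin_num.
Proof.
move=> calpha; apply: integrable_fin_num => //.
apply: measurable_bounded_integrable => //.
- rewrite ltey_eq; apply/orP; left.
  exact: (fin_num_measure (charge_variation (hahn_setsP nu))).
- apply/measurable_EFinP.
  exact: measurable_int (continuous_integrable_itvoo calpha).
- exact: continuous_bounded_itvoo.
Qed.

(** Along [u + c] the fidelity term is a quadratic polynomial in [c]. Its minimum is at [c = 0],
    which forces the linear coefficient, a multiple of the mean of [f - u], to vanish. *)
Lemma weighted_TV_solution_mean0 (alpha f u : R -> R) :
  {within `[a, b], continuous alpha} ->
  mu.-integrable D (EFin \o (fun x => f x - u x)) ->
  mu.-integrable D (EFin \o (fun x => (f x - u x) ^+ 2)) ->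
  weighted_TV_solution D alpha f u ->
  \int[mu]_(x in D) (f x - u x) = 0.
Proof.
move=> calpha iw iw2 [BVu min_u]; have [iu _] := BVu.
set w := (fun x => f x - u x) in iw iw2 *.
set I1 := \int[mu]_(x in D) _.
pose I2 := \int[mu]_(x in D) (w x ^+ 2).
have min_c c : I2 <= I2 + (- (2 * c) * I1 + c ^+ 2 * (b - a)).
  have := min_u _ (BVDcst c BVu).
  rewrite /weighted_TV_energy distributional_derivativeDcst//.
  (* The common total variation term is cancelled, then the factor one half. *)
  rewrite leeD2rE ?total_variation_integral_fin_num//.
  rewrite lee_pmul2l ?lte_fin ?invr_gt0//.
  have i1 : mu.-integrable D (EFin \o (fun x => - (2 * c) * w x)).
    exact: (@integrableZl _ _ _ mu D _ (- (2 * c)) (EFin \o w)).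
  have i0 : mu.-integrable D (EFin \o cst (c ^+ 2)).
    exact/continuous_integrable_itvoo/continuous_subspaceT/cst_continuous.
  have i10 : mu.-integrable D (EFin \o (fun x => - (2 * c) * w x + cst (c ^+ 2) x)).
    exact: integrableD i1 i0.
  have i210 : mu.-integrable D
      (EFin \o (fun x => w x ^+ 2 + (- (2 * c) * w x + cst (c ^+ 2) x))).
    exact: integrableD iw2 i10.
  under [leRHS]eq_integral => x _.
    have -> : (f x - (u x + c)) ^+ 2 =
              w x ^+ 2 + (- (2 * c) * w x + cst (c ^+ 2) x).
      by rewrite /w /=; ring.
    over.
  rewrite -[leLHS]fineK ?integrable_fin_num//.
  rewrite -[leRHS]fineK ?integrable_fin_num// lee_fin.
  rewrite -!/(Rintegral _ _ _) !RintegralD// RintegralZl//.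
  by rewrite Rintegral_cst//= lebesgue_measure_itv/= lte_fin ab.
have ba0 : 0 < b - a by rewrite subr_gt0.
(* The mean of [w] is the value of [c] that minimises the quadratic; there the increment is
   [- I1 ^+ 2 / (b - a)], so its nonnegativity gives [I1 = 0]. *)
have := min_c (I1 / (b - a)); rewrite lerDl.
have -> : - (2 * (I1 / (b - a))) * I1 + (I1 / (b - a)) ^+ 2 * (b - a) =
          - (I1 ^+ 2 / (b - a)) by field; rewrite gt_eqF.
rewrite oppr_ge0 pmulr_lle0 ?invr_gt0// => I1_le0.
by apply/eqP; rewrite -sqrf_eq0 eq_le I1_le0 sqr_ge0.
Qed.

End translation.

(** * The residual of a linear function truncated to an interval *)

Lemma Rintegral_affine (R : realType) (a b m lambda : R) : a < b ->
  \int[@lebesgue_measure R]_(x in `]a, b[) (lambda * (x - m)) =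
  lambda / 2 * ((b - m) ^+ 2 - (a - m) ^+ 2).
Proof.
move=> ab; pose G (x : R) := lambda / 2 * (x - m) ^+ 2.
have dG (x : R) : is_derive x 1 G (lambda * (x - m)).
  by apply: is_derive_eq; rewrite /GRing.scale/=; field.
rewrite (Rintegral_FTC2_itvoo ab _ dG); first by rewrite /G; ring.
apply: derivable_within_continuous => x _; exact: ex_derive.
Qed.

(** [Num.max x1 (Num.min x x2)] clamps [x] to the interval from [x1] to [x2]; this single formula
    replaces the three cases defining [u]. *)
Lemma continuous_truncation_residual (R : realType) (x1 x2 lambda : R) :
  continuous (fun x : R => lambda * (x - Num.max x1 (Num.min x x2))).
Proof.
move=> x; apply: cvgM; first exact: cvg_cst.
apply: cvgB; first exact: cvg_id.
apply: (@continuous_max _ _ (cst x1) (fun x => Num.min x x2)).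
  exact: cst_continuous.
apply: (@continuous_min _ _ id (cst x2)); first exact: cvg_id.
exact: cst_continuous.
Qed.

(** Cut at [x1] and [x2]: the residual is zero in the middle and affine on each outer piece,
    vanishing at the cut point. *)
Lemma Rintegral_truncation_residual (R : realType) (a b x1 x2 lambda : R) :
  a < x1 -> x1 <= x2 -> x2 < b ->
  \int[@lebesgue_measure R]_(x in `]a, b[)
     (lambda * (x - Num.max x1 (Num.min x x2))) =
  lambda / 2 * ((b - x2) ^+ 2 - (x1 - a) ^+ 2).
Proof.
move=> ax1 x12 x2b; pose w (x : R) := lambda * (x - Num.max x1 (Num.min x x2)).
have iw p q : (@lebesgue_measure R).-integrable `]p, q[ (EFin \o w).
  apply/continuous_integrable_itvoo/continuous_subspaceT.
  exact: continuous_truncation_residual.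
(* Each cut leaves a left piece closed at the cut point; these are made open afterwards, at no cost
   to the integral. *)
have := Rintegral_itvB (x := x1) (iw a b).
rewrite !bnd_simp => /(_ (ltW ax1) (le_lt_trans x12 x2b)) /(canRL (subrK _)) ->.
have := Rintegral_itvB (x := x2) (iw x1 b).
rewrite !bnd_simp => /(_ x12 x2b) /(canRL (subrK _)) ->.
rewrite -!Rintegral_itv_bndo_bndc//.
have -> : \int[lebesgue_measure]_(x in `]x2, b[) w x =
          \int[lebesgue_measure]_(x in `]x2, b[) (lambda * (x - x2)).
  apply: eq_Rintegral => x; rewrite inE/= in_itv/= /w => /andP[x2x _].
  by rewrite min_r ?max_r// ltW.
have -> : \int[lebesgue_measure]_(x in `]x1, x2[) w x =
          \int[lebesgue_measure]_(x in `]x1, x2[) cst 0 x.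
  apply: eq_Rintegral => x; rewrite inE/= in_itv/= /w => /andP[x1x xx2].
  by rewrite min_l ?max_r ?subrr ?mulr0// ltW.
have -> : \int[lebesgue_measure]_(x in `]a, x1[) w x =
          \int[lebesgue_measure]_(x in `]a, x1[) (lambda * (x - x1)).
  apply: eq_Rintegral => x; rewrite inE/= in_itv/= /w => /andP[_ xx1].
  by rewrite max_l// ge_min ltW.
rewrite Rintegral_cst// mul0r addr0 !Rintegral_affine//.
by ring.
Qed.

Unset Implicit Arguments.

Theorem proposition6p4 (R : realType) (L lambda x1 x2 : R) (alpha f u : R -> R)
  (L_gt0 : 0 < L)
  (alpha_continuous : {within `[- L, L], continuous alpha})
  (alpha_gt0 : forall x, x \in `[- L, L] -> 0 < alpha x)
  (lambda_gt0 : 0 < lambda)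
  (fE : forall x, x \in `]- L, L[ -> f x = lambda * x)
  (x1_gt : - L < x1) (x1_le_x2 : x1 <= x2) (x2_lt : x2 < L)
  (uE1 : forall x, x \in `]- L, x1[ -> u x = lambda * x1)
  (uE : forall x, x \in `[x1, x2] -> u x = lambda * x)
  (uE2 : forall x, x \in `]x2, L[ -> u x = lambda * x2)
  (u_solution : weighted_TV_solution `]- L, L[ alpha f u) :
  x1 = - x2.
Proof.
(* Inside the domain, [f - u] is the continuous clamp residual. The values of [f] and [u] elsewhere
   are unconstrained, hence the restriction. *)
have fuE : {in [set` `]- L, L[],
    (fun x => lambda * (x - Num.max x1 (Num.min x x2))) =1 (fun x => f x - u x)}.
  move=> x /[!inE] xL; rewrite fE// mulrBr; congr (_ - _).
  have := xL; rewrite /= in_itv/= => /andP[Lx xL'].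
  have [xx1|x1x] := ltP x x1.
    by rewrite uE1 ?in_itv/= ?Lx// max_l// ge_min ltW.
  have [xx2|x2x] := leP x x2.
    by rewrite uE ?in_itv/= ?x1x// max_r.
  by rewrite uE2 ?in_itv/= ?x2x// max_r.
have cw := @continuous_truncation_residual R x1 x2 lambda.
have LL : - L < L by lra.
have iw : (@lebesgue_measure R).-integrable `]- L, L[
    (EFin \o (fun x => f x - u x)).
  have := continuous_integrable_itvoo (@continuous_subspaceT _ _ [set` `[- L, L]] _ cw).
  by apply: eq_integrable => // x xL /=; rewrite fuE.
have iw2 : (@lebesgue_measure R).-integrable `]- L, L[
    (EFin \o (fun x => (f x - u x) ^+ 2)).
  have cw2 : continuous (fun x : R =>
      (lambda * (x - Num.max x1 (Num.min x x2))) ^+ 2).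
    by move=> x; apply: cvgM; exact: cw.
  have := continuous_integrable_itvoo (@continuous_subspaceT _ _ [set` `[- L, L]] _ cw2).
  by apply: eq_integrable => // x xL /=; rewrite -fuE.
have := weighted_TV_solution_mean0 LL alpha_continuous iw iw2 u_solution.
have <- : \int[lebesgue_measure]_(x in `]- L, L[)
            (lambda * (x - Num.max x1 (Num.min x x2))) =
          \int[lebesgue_measure]_(x in `]- L, L[) (f x - u x).
  exact: eq_Rintegral.
rewrite Rintegral_truncation_residual// => /eqP; rewrite mulf_eq0 gt_eqF ?divr_gt0//= subr_eq0.
(* The squares of [L - x2] and [x1 + L] agree and both numbers are nonnegative, so the numbers
   themselves agree. *)
rewrite eqrXn2 ?subr_ge0 ?ltW// => /eqP; lra.
Qed.
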